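(* Let $D$ be an in-semicomplete digraph, $k$ a positive integer, and $\mathcal{P}$ a $k$-pack of $D$. Then there exists either (i) a coloring of $D$ orthogonal to $\mathcal{P}$, or (ii) a $k$-pack $\mathcal{Q}$ of $D$ such that $\|\mathcal{Q}\| = \|\mathcal{P}\| + 1$ and $e(\mathcal{Q}) \subseteq e(\mathcal{P}) \cup (V(D)\setminus V(\mathcal{P}))$, where $V(\mathcal{P})$ is the set of vertices covered by the paths of $\mathcal{P}$.
   Context: Digraphs are finite, without loops or parallel arcs (directed 2-cycles allowed). Vertices $u,v$ are adjacent if $uv$ or $vu$ is an arc. A digraph is semicomplete if every two distinct vertices are adjacent; $D$ is (locally) in-semicomplete if for every vertex $v$ the in-neighborhood $\{u : uv \in A(D)\}$ induces a semicomplete digraph. A path is a nonempty sequence $v_1\dots v_\ell$ of distinct vertices with $v_iv_{i+1}\in A(D)$; its end is $e(P)=v_\ell$. A $k$-pack of $D$ is a set of at most $k$ pairwise vertex-disjoint paths of $D$; its weight $\|\mathcal{P}\|$ is the number of vertices covered by its paths. For a set $\mathcal{P}$ of paths, $e(\mathcal{P})=\{e(P):P\in\mathcal{P}\}$. A set of vertices is stable if its vertices are pairwise nonadjacent. A coloring of $D$ is a partition of $V(D)$ into stable sets (color classes). A coloring $\mathcal{C}$ and a $k$-pack $\mathcal{P}$ are orthogonal if each color class $C\in\mathcal{C}$ meets $\min\{|C|,k\}$ distinct paths of $\mathcal{P}$. *)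

(* Defs.v *)
From mathcomp Require Import all_boot.

Set Implicit Arguments.
Unset Strict Implicit.
Unset Printing Implicit Defensive.

(* A digraph on the finite vertex type [T] is an irreflexive relation [D];
   [D u v] means that [uv] is an arc. *)
Section Digraph.
Variables (T : finType) (D : rel T).

Definition adjacent (u v : T) : bool := D u v || D v u.

Definition induces_semicomplete (A : {set T}) : Prop :=
  {in A &, forall u v, u != v -> adjacent u v}.

Definition in_neighborhood (v : T) : {set T} := [set u | D u v].

Definition in_semicomplete : Prop :=
  forall v, induces_semicomplete (in_neighborhood v).

Definition is_dipath (p : seq T) : bool :=
  if p is x :: q then path D x q && uniq (x :: q) else false.

Definition stable (A : {set T}) : Prop :=
  {in A &, forall u v, ~~ adjacent u v}.

(* [partition] requires the blocks to be nonempty. *)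
Definition coloring (C : {set {set T}}) : Prop :=
  partition C [set: T] /\ {in C, forall A, stable A}.

(* A set of paths is represented by a duplicate-free sequence. *)
Definition is_pack (k : nat) (P : seq (seq T)) : Prop :=
  [/\ uniq P,
      size P <= k,
      {in P, forall p, is_dipath p} &
      {in P &, forall p q : seq T, p != q -> [disjoint p & q]}].

End Digraph.

Section Packs.
Variable T : finType.

Definition covered (P : seq (seq T)) : {set T} := [set v in flatten P].

Definition weight (P : seq (seq T)) : nat := #|covered P|.

Definition path_end (p : seq T) : option T :=
  if p is x :: q then Some (last x q) else None.

Definition ends (P : seq (seq T)) : {set T} := [set v in pmap path_end P].

Definition meets (A : {set T}) (p : seq T) : bool := has (mem A) p.

Definition orthogonal (k : nat) (C : {set {set T}}) (P : seq (seq T)) : Prop :=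
  {in C, forall A : {set T}, count (meets A) P = minn #|A| k}.

End Packs.

(* Main.v *)
(** In an in-semicomplete digraph the ancestors of a vertex are pairwise
    comparable for reachability, so reachability (linearized inside strong
    components) is a forest order.  Color each vertex by its height, the length
    of a longest chain going up from it.  The classes are antichains, so a
    [k]-pack has weight at most [N], the sum over the classes [A] of
    [minn #|A| k], with equality iff the coloring is orthogonal to it.

    In a forest order some set [L] of at most [k] vertices has at least [N]
    ancestors.  If [P] has weight less than [N], replace each vertex of [L] on
    a path of [P] by the end of that path; this only adds ancestors.  Inserting
    ancestors one at a time then yields [k]-packs with ends in [L] and any
    prescribed weight up to the number of ancestors. *)

Require Import Defs.
From mathcomp Require Import all_boot.

Set Implicit Arguments.
Unset Strict Implicit.
Unset Printing Implicit Defensive.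

(** * Packs as duplicate-free concatenations, and insertion of ancestors *)

Section FlattenPacks.
Variables (T : finType) (D : rel T).
Implicit Types (P : seq (seq T)) (p : seq T) (A : {set T}).

(** Dipaths are nonempty, so a repeated path, like two paths that meet, repeats a vertex of the
    concatenation: a single [uniq] replaces distinctness and disjointness. *)
Lemma is_packE k P : is_pack D k P <->
  [/\ size P <= k, all (is_dipath D) P & uniq (flatten P)].
Proof.
split=> [[uP sP dP disP]|[sP /allP dP uP]].
  split=> //; first exact/allP.
  elim: P uP dP disP {sP} => //= p P IH /andP[pP uP] dP disP.
  rewrite cat_uniq IH ?andbT //; first last.
  - by move=> a b aP bP; apply: disP; rewrite inE ?aP ?bP orbT.
  - by move=> a aP; apply: dP; rewrite inE aP orbT.
  have dp : is_dipath D p by apply: dP; rewrite mem_head.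
  apply/andP; split; first by case: p dp {pP dP disP} => // x q /andP[].
  apply/hasPn => x /flattenP[q qP xq]; apply: contraL xq => xp.
  have pq : p != q by apply: contraNneq pP => ->.
  have := disP p q (mem_head _ _) _ pq; rewrite inE qP orbT => /(_ isT) dpq.
  by rewrite (disjointFr dpq xp).
have sub : {in P, forall p, is_dipath D p} by [].
split=> //.
- elim: P uP dP {sP sub} => //= p P IH; rewrite cat_uniq => /and3P[_ nP uP] dP.
  rewrite IH ?andbT // => [|q qP]; last by apply: dP; rewrite inE qP orbT.
  apply: contra nP => pP; have := dP p (mem_head _ _).
  case: p pP {dP} => // x q pP _; apply/hasP; exists x; last exact: mem_head.
  by apply/flattenP; exists (x :: q) => //; apply: mem_head.
- elim: P uP {sP dP sub} => //= p P IH; rewrite cat_uniq => /and3P[_ nP uP] a b.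
  have key c : c \in P -> [disjoint p & c].
    move=> cP; rewrite disjoint_sym disjoint_subset; apply/subsetP => x xc.
    apply: contra nP => xp; apply/hasP; exists x => //.
    by apply/flattenP; exists c.
  rewrite !inE => /predU1P[->|aP] /predU1P[->|bP]; first by rewrite eqxx.
  - by move=> _; apply: key.
  - by move=> _; rewrite disjoint_sym; apply: key.
  - exact: IH.
Qed.

Lemma weight_uniq_flatten P : uniq (flatten P) -> weight P = size (flatten P).
Proof. by move=> uP; rewrite /weight cardsE; apply/card_uniqP. Qed.

Lemma card_covered_flatten A P : uniq (flatten P) ->
  #|A :&: covered P| = count (mem A) (flatten P).
Proof.
move=> uP; rewrite -size_filter -(card_uniqP (filter_uniq _ uP)) -cardsE.
by apply: eq_card => x; rewrite !inE mem_filter.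
Qed.

Lemma mem_ends P v :
  (v \in ends P) = has (fun p => path_end p == Some v) P.
Proof.
rewrite inE; elim: P => //= p P IH; case: (path_end p) => //= x.
by rewrite inE IH eq_sym.
Qed.

Lemma ends_perm P Q : perm_eq P Q -> ends P = ends Q.
Proof. by move=> /perm_has pPQ; apply/setP => v; rewrite !mem_ends pPQ. Qed.

Lemma perm_swap (x y : T) s : perm_eq [:: x, y & s] [:: y, x & s].
Proof. by rewrite (perm_catCA [:: x] [:: y] s). Qed.

(* The vertex goes just before the first vertex of the path it dominates:
   the predecessor of the latter is then adjacent to, but not dominated by, it. *)
Lemma path_insert x p a b : in_semicomplete D -> path D x p ->
  a \notin x :: p -> ~~ D a x -> b \in p -> D a b ->
  exists q, [/\ path D x q, perm_eq q (a :: p) & last x q = last x p].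
Proof.
move=> semi; elim: p x => //= y p IH x /andP[Dxy pth].
rewrite inE negb_or => /andP[nax nayp] nDax byp Dab.
have [Day|nDay] := boolP (D a y).
  exists [:: a, y & p]; split=> //=; rewrite Day pth !andbT.
  have := semi y a x; rewrite !inE => /(_ Day Dxy nax); rewrite /adjacent.
  by rewrite (negPf nDax).
have bp : b \in p.
  by move: byp; rewrite inE => /predU1P[by_|//]; rewrite -by_ Dab in nDay.
have [q [pq eq lq]] := IH y pth nayp nDay bp Dab.
exists (y :: q); split=> //=; first by rewrite Dxy.
by apply: perm_trans (_ : perm_eq (y :: a :: p) _); rewrite ?perm_cons ?perm_swap.
Qed.

(** When [a] dominates the first vertex, the case [path_insert] excludes, it is prepended; either
    way the end is kept. *)
Lemma dipath_insert p a b : in_semicomplete D -> is_dipath D p ->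
  a \notin p -> b \in p -> D a b ->
  exists q, [/\ is_dipath D q, perm_eq q (a :: p) & path_end q = path_end p].
Proof.
move=> semi; case: p => // x p /andP[pth uxp] na bxp Dab.
have [Dax|nDax] := boolP (D a x).
  by exists [:: a, x & p]; split=> //; rewrite /is_dipath cons_uniq na uxp /= Dax pth.
have bp : b \in p.
  by move: bxp; rewrite inE => /predU1P[bx|//]; rewrite -bx Dab in nDax.
have [q [pq eq lq]] := path_insert semi pth na nDax bp Dab.
have eq' : perm_eq (x :: q) (a :: x :: p).
  by apply: perm_trans (_ : perm_eq (x :: a :: p) _); rewrite ?perm_cons ?perm_swap.
exists (x :: q); split=> //=; last by rewrite lq.
by rewrite pq -cons_uniq (perm_uniq eq') cons_uniq na.
Qed.

Definition ancestors (L : {set T}) : {set T} :=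
  [set v | [exists l in L, connect D v l]].

Lemma pack_of_ancestors (L : {set T}) n : in_semicomplete D ->
  n <= #|ancestors L| ->
  exists Q, [/\ is_pack D #|L| Q, weight Q = n & ends Q \subset L].
Proof.
move=> semi le_n.
(* Bounding the number of paths by the covered part of [L] leaves room for a new path at any
   uncovered vertex of [L]. *)
suff [Q [dQ uQ <- sQ eQ]] : exists Q, [/\ all (is_dipath D) Q, uniq (flatten Q),
    size (flatten Q) = n, size Q <= #|L :&: covered Q| & ends Q \subset L].
  exists Q; split=> //; last exact: weight_uniq_flatten.
  by apply/is_packE; split=> //; apply: (leq_trans sQ); rewrite subset_leq_card ?subsetIl.
elim: n le_n => [|n IH] lt_n.
  by exists [::]; split=> //; apply/subsetP => v; rewrite mem_ends.
have [Q [dQ uQ szQ sQ eQ]] := IH (ltnW lt_n).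
have /subsetPn[v] : ~~ (ancestors L \subset covered Q).
  apply: contraL lt_n => /subset_leq_card; rewrite -leqNgt => /leq_trans; apply.
  by rewrite -szQ -weight_uniq_flatten.
rewrite inE => /existsP[l /andP[lL /connectP[p]]]; rewrite inE.
(* The walk from [v] is followed while uncovered. Either its end in [L] is reached and becomes a
   one-vertex path, or the vertex just before the first covered one is inserted into the path of the
   latter. *)
elim: p v => [|y p IHp] v /= => [_ lst|/andP[Dvy pth] lst] nvQ.
  exists ([:: v] :: Q); split=> //=.
  - by rewrite nvQ.
  - by rewrite szQ.
  - rewrite -add1n; apply: leq_trans (leq_add (leqnn 1) sQ) _.
    rewrite -(cards1 v) -cardsUI [X in _ + X](_ : _ = 0) ?addn0; last first.
      apply/eqP; rewrite cards_eq0; apply/eqP/setP => a; rewrite !inE.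
      by apply/and3P => -[/eqP-> _ vQ]; rewrite vQ in nvQ.
    apply/subset_leq_card/subsetP => a; rewrite !inE.
    by case/orP => [/eqP->|/andP[-> ->]]; rewrite ?eqxx ?lst ?orbT ?andbT -?lst.
  - apply/subsetP => a; rewrite mem_ends /= => /orP[/eqP[<-]|]; first by rewrite -lst.
    by rewrite -mem_ends; apply: (subsetP eQ).
have [yQ|] := boolP (y \in flatten Q); last exact: IHp.
have /flattenP[q qQ yq] := yQ.
have nvq : v \notin q by apply: contra nvQ => vq; apply/flattenP; exists q.
have [q' [dq' pq' eq']] := dipath_insert semi (allP dQ q qQ) nvq yq Dvy.
have pQ := perm_to_rem qQ.
have pf : perm_eq (flatten (q' :: rem q Q)) (v :: flatten Q).
  apply: (@perm_trans _ (v :: flatten (q :: rem q Q))); last first.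
    by rewrite perm_cons perm_sym perm_flatten.
  by rewrite /= -cat_cons perm_cat2r.
exists (q' :: rem q Q); split.
- rewrite /= dq'; apply/allP => a /mem_rem; exact: (allP dQ).
- by rewrite (perm_uniq pf) /= nvQ.
- by rewrite (perm_size pf) /= szQ.
- rewrite (perm_size pQ) /= in sQ; apply: leq_trans sQ _; apply/subset_leq_card/setIS.
  by apply/subsetP => a; rewrite !inE (perm_mem pf) inE => ->; rewrite orbT.
- apply: subset_trans eQ; rewrite (ends_perm pQ); apply/subsetP => a.
  by rewrite !mem_ends /= eq'.
Qed.

End FlattenPacks.

Lemma set_of_card_between (T : finType) (A B : {set T}) n : A \subset B ->
  #|A| <= n <= #|B| -> exists X : {set T}, [/\ A \subset X, X \subset B & #|X| = n].
Proof.
move=> sAB /andP[]; elim: n => [|n IH].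
  by rewrite leqn0 => /eqP cA _; exists A.
rewrite leq_eqVlt => /predU1P[<- _|le_A lt_B]; first by exists A.
have [X [sAX sXB cX]] := IH le_A (ltnW lt_B).
have /subsetPn[v vB vX] : ~~ (B \subset X).
  by apply: contraL lt_B => /subset_leq_card; rewrite cX -leqNgt.
exists (v |: X); rewrite cardsU1 vX cX; split=> //.
  exact: subset_trans sAX (subsetUr _ _).
by rewrite subUset sub1set vB.
Qed.

(** * Heights in a strict order, and covering the levels of a forest order *)

Section Height.
Variables (T : finType) (lt : rel T).
Hypotheses (lt_irr : irreflexive lt) (lt_tr : transitive lt).

Fixpoint height_upto n u :=
  if n is m.+1 then \max_(v | lt u v) (height_upto m v).+1 else 0.

Definition height := height_upto #|T|.

(** Passing from [u] to some [v] above it strictly shrinks the set of elements above, so the size of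
    that set is enough fuel. *)
Lemma height_upto_stable n u : #|lt u| <= n -> height_upto n u = height_upto n.+1 u.
Proof.
elim: n u => [|n IH] u le_n.
  rewrite /= big1 // => v uv; move: le_n; rewrite leqn0 => /eqP/card0_eq/(_ v).
  by rewrite -topredE /= uv.
apply: eq_bigr => v uv; congr _.+1; apply: IH; rewrite -ltnS (leq_trans _ le_n) //.
apply/proper_card/properP; split; first by apply/subsetP => w; apply: lt_tr.
by exists v; rewrite // -topredE /= lt_irr.
Qed.

Lemma heightE u : height u = \max_(v | lt u v) (height v).+1.
Proof. by rewrite {1}/height height_upto_stable // max_card. Qed.

Lemma lt_height u v : lt u v -> height v < height u.
Proof. by move=> uv; rewrite (heightE u) (bigmax_sup v). Qed.

Lemma height_succ u j : height u = j.+1 -> exists2 v, lt u v & height v = j.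
Proof.
rewrite heightE => hu; have gt0 : 0 < #|lt u|.
  rewrite lt0n; apply: contra_eqN hu => /eqP/card0_eq up0; by rewrite big_pred0.
have [v uv maxE] := eq_bigmax_cond (fun v => (height v).+1) gt0.
by exists v => //; apply: succn_inj; rewrite -maxE -hu.
Qed.

Lemma sum_card_levels (X : {set T}) :
  #|X| = \sum_(j < (\max_u height u).+1) #|[set v | height v == j] :&: X|.
Proof.
pose h v : 'I_(\max_u height u).+1 := Ordinal (leq_bigmax (F := height) v : _ < _.+1).
rewrite -sum1_card (partition_big h xpredT) //=; apply: eq_bigr => j _.
by rewrite -sum1_card; apply: eq_bigl => v; rewrite !inE andbC.
Qed.

Hypothesis lt_forest : forall u v w, lt u w -> lt v w -> [\/ u = v, lt u v | lt v u].

(* Levels are treated from the top of the height function down: injectively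
   pushing the chosen vertices of a level to the next one keeps what they cover. *)
Lemma cover_levels k : exists2 L : {set T}, #|L| <= k &
  forall j, minn #|[set v | height v == j]| k
    <= #|[set v | height v == j] :&: [set v | [exists l in L, (v == l) || lt v l]]|.
Proof.
pose A (j : nat) := [set v | height v == j].
pose down (L : {set T}) := [set v | [exists l in L, (v == l) || lt v l]].
have down_sub (L L' : {set T}) : L \subset down L' -> down L \subset down L'.
  move=> /subsetP sub; apply/subsetP => v; rewrite !inE => /existsP[l /andP[lL vl]].
  have := sub l lL; rewrite inE => /existsP[l' /andP[l'L ll']].
  apply/existsP; exists l'; rewrite l'L /=.
  case/predU1P: vl => [->//|vl]; case/predU1P: ll' => [<-|ll']; rewrite ?vl ?orbT //.
  by rewrite (lt_tr vl ll') orbT.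
have self_down (L : {set T}) : L \subset down L.
  by apply/subsetP => v vL; rewrite inE; apply/existsP; exists v; rewrite vL eqxx.
(* Level [m - i] descends as [i] grows: levels from [m] on are empty, and [i = m] reaches level
   0. *)
suff key m i : (forall j, m <= j -> #|A j| = 0) -> i <= m -> exists L : {set T},
    [/\ L \subset A (m - i), #|L| = minn #|A (m - i)| k &
      forall j, m - i <= j -> minn #|A j| k <= #|A j :&: down L|].
  have [j|//|L [_ cL covL]] := key (\max_u height u).+1 (\max_u height u).+1.
    move=> lt_j; apply/eqP; rewrite cards_eq0; apply/eqP/setP => v; rewrite !inE.
    by apply/eqP => hv; have := leq_bigmax (F := height) v; rewrite hv leqNgt lt_j.
  exists L => [|j]; first by rewrite cL geq_minr.
  by apply: covL; rewrite subnn.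
move=> A0; elim: i => [_|i IH lt_i].
  exists set0; rewrite sub0set cards0 subn0 A0 // min0n; split=> // j le_j.
  by rewrite A0 // min0n.
have [L [sL cL covL]] := IH (ltnW lt_i); set n := m - i.+1.
have nS : m - i = n.+1 by rewrite /n subnSK.
rewrite nS in sL cL covL.
have hL v : v \in L -> height v = n.+1.
  by move=> /(subsetP sL); rewrite inE => /eqP.
have [f fP] : exists f : T -> T, forall v, v \in L -> lt v (f v) /\ height (f v) = n.
  apply: (fin_all_exists (P := fun v w => v \in L -> lt v w /\ height w = n)) => v.
  have [/hL/height_succ[w vw hw]|] := boolP (v \in L); first by exists w.
  by exists v.
(* A common image lies above both [u] and [v], so the forest hypothesis makes them equal or
   comparable; equal heights exclude the latter. *)
have f_inj : {in L &, injective f}.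
  move=> u v uL vL fuv; have [ufu _] := fP u uL; have [vfv _] := fP v vL.
  rewrite -fuv in vfv; have [//|/lt_height|/lt_height] := lt_forest ufu vfv;
  by rewrite !hL ?ltnn.
have fL : f @: L \subset A n.
  by apply/subsetP => _ /imsetP[v vL ->]; rewrite inE; have [_ ->] := fP v vL.
have cf : #|f @: L| = minn #|A n.+1| k by rewrite card_in_imset.
have le_f : #|f @: L| <= minn #|A n| k.
  by rewrite leq_min subset_leq_card // cf geq_minr.
have [L' [fL' L'A cL']] : exists L' : {set T},
    [/\ f @: L \subset L', L' \subset A n & #|L'| = minn #|A n| k].
  by apply: set_of_card_between; rewrite ?le_f ?geq_minl.
exists L'; split=> // j le_j.
have [->|ne_j] := eqVneq j n.
  rewrite -cL'; apply/subset_leq_card; rewrite subsetI L'A; exact: self_down.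
(* On the levels [j > n], [L'] covers all that [L] covers, since [f v] lies above [v]. *)
apply: leq_trans (covL j _) _; first by rewrite ltn_neqAle eq_sym ne_j.
apply/subset_leq_card/setIS/down_sub/subsetP => v vL; rewrite inE.
apply/existsP; exists (f v); have [-> _] := fP v vL.
by rewrite orbT andbT; apply/(subsetP fL')/imset_f.
Qed.
End Height.

(** * Reachability as a forest order, and its levels as color classes *)

Section InSemicomplete.
Variables (T : finType) (D : rel T).
Hypothesis semi : in_semicomplete D.

(** Induction from the end of the walk to [y]: [x] and the penultimate vertex both dominate [y], so
    they are equal or adjacent. An arc from [x] shortens the walk; otherwise [v] reaches [x]. *)
Lemma connect_arc_comparable x y v : D x y -> connect D v y ->
  connect D x v \/ connect D v x.
Proof.
move=> Dxy /connectP[p]; elim/last_ind: p y Dxy => [|p z IH] y Dxy.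
  by move=> _ /= <-; left; apply: connect1.
rewrite rcons_path last_rcons => /andP[pth Dz] yz; rewrite {y}yz in Dxy.
have [xl|nxl] := eqVneq x (last v p).
  by right; apply/connectP; exists p.
have := @semi z x (last v p).
rewrite !inE => /(_ Dxy Dz nxl)/orP[Dxl|Dlx]; first exact: IH Dxl pth _.
by right; apply: connect_trans (connect1 Dlx); apply/connectP; exists p.
Qed.

(** Induction along the walk from [u]: its second vertex is comparable with [v], and if [v] reaches
    it the previous lemma applies to the first arc. *)
Lemma connect_comparable u v w : connect D u w -> connect D v w ->
  connect D u v \/ connect D v u.
Proof.
move=> /connectP[p pth ->]; elim: p u pth => [|y p IH] u /= => [_|/andP[Duy pth]] cv.
  by right.
have [yv|vy] := IH y pth cv; last exact: connect_arc_comparable Duy vy.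
by left; apply: connect_trans (connect1 Duy) yv.
Qed.

(* Reachability, with ties inside a strong component broken by enumeration. *)
Definition reach_lt : rel T := fun u v =>
  connect D u v && (connect D v u ==> (enum_rank u < enum_rank v)).

Lemma reach_lt_irr : irreflexive reach_lt.
Proof. by move=> u; rewrite /reach_lt connect0 ltnn. Qed.

Lemma reach_lt_trans : transitive reach_lt.
Proof.
move=> v u w /andP[uv /implyP ruv] /andP[vw /implyP rvw].
rewrite /reach_lt (connect_trans uv vw); apply/implyP => wu.
apply: ltn_trans (ruv _) (rvw _); first exact: connect_trans vw wu.
exact: connect_trans wu uv.
Qed.

Lemma connect_reach_lt u v : connect D u v -> [\/ u = v, reach_lt u v | reach_lt v u].
Proof.
move=> uv; rewrite /reach_lt uv /=; case: (boolP (connect D v u)) => /= vu.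
  case: (ltngtP (enum_rank u) (enum_rank v)) => [_|_|/ord_inj/enum_rank_inj ->].
  - by constructor 2.
  - by constructor 3.
  - by constructor 1.
by constructor 2.
Qed.

Lemma reach_lt_forest u v w : reach_lt u w -> reach_lt v w ->
  [\/ u = v, reach_lt u v | reach_lt v u].
Proof.
move=> /andP[uw _] /andP[vw _].
have [uv|vu] := connect_comparable uw vw; first exact: connect_reach_lt.
by case: (connect_reach_lt vu) => [->|H|H]; [constructor 1|constructor 3|constructor 2].
Qed.

Definition level j : {set T} := [set v | height reach_lt v == j].

(** Distinct connected vertices are comparable for [reach_lt], hence differ in height. *)
Lemma connect_same_level u v j : u \in level j -> v \in level j ->
  connect D u v -> u = v.
Proof.
have lth := lt_height reach_lt_irr reach_lt_trans.
rewrite !inE => /eqP hu /eqP hv /connect_reach_lt[//|/lth|/lth];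
by rewrite hu hv ltnn.
Qed.

Lemma level_coloring : irreflexive D ->
  coloring D (preim_partition (height reach_lt) setT) /\
  {in preim_partition (height reach_lt) setT, forall A, exists j, A = level j}.
Proof.
move=> irr; have levels : {in preim_partition (height reach_lt) setT,
    forall A, exists j, A = level j}.
  move=> _ /imsetP[x _ ->]; exists (height reach_lt x).
  by apply/setP => v; rewrite !inE eq_sym.
split=> //; split; first exact: preim_partitionP.
move=> _ /levels[j ->] u v uj vj; apply/negP => /orP[] Duv.
  by have := connect_same_level uj vj (connect1 Duv) => uv; rewrite uv irr in Duv.
by have := connect_same_level vj uj (connect1 Duv) => uv; rewrite uv irr in Duv.
Qed.

(** Of two vertices on a path the earlier reaches the later, so each path has at most one vertex in
    a level. *)
Lemma count_meets_level k P j : is_pack D k P ->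
  count (meets (level j)) P = #|level j :&: covered P|.
Proof.
move=> /is_packE[_ dP uP]; rewrite card_covered_flatten // count_flatten.
rewrite -sumn_count; congr sumn; apply/eq_in_map => p pP; rewrite /meets.
have /= := allP dP p pP; case: p pP => // x q pP /andP[pth uxq].
rewrite has_count; suff : count (mem (level j)) (x :: q) <= 1 by case: (count _ _) => [|[]].
rewrite -size_filter; case E: (filter _ _) => [//|a [//|b s]].
have sub : subseq [:: a; b] (x :: q).
  by apply: subseq_trans (filter_subseq (mem (level j)) _); rewrite E /= !eqxx sub0seq.
have : sorted (connect D) (x :: q) by apply: sub_path pth; apply: connect1.
move=> /(subseq_sorted (@connect_trans _ D) sub) /=; rewrite andbT => ab.
have lvl c : c \in [:: a, b & s] -> c \in level j by rewrite -E mem_filter => /andP[].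
have := subseq_uniq sub uxq; rewrite /= inE andbT.
by rewrite (connect_same_level (lvl a _) (lvl b _) ab) ?eqxx // !inE eqxx ?orbT.
Qed.

Lemma connect_end k P v : is_pack D k P -> v \in covered P ->
  exists2 e, e \in ends P & connect D v e.
Proof.
move=> [_ _ dP _]; rewrite inE => /flattenP[p pP vp].
have := dP p pP; case: p pP vp => // x q pP vp /andP[pth _].
exists (last x q); first by rewrite mem_ends; apply/hasP; exists (x :: q).
case/splitPl: vp pth => p1 p2 <-; rewrite cat_path last_cat => /andP[_ pth].
by apply/connectP; exists p2.
Qed.

End InSemicomplete.

(** * The dichotomy: all levels saturated, or a pack of larger weight *)

Theorem theorem3p2 (T : finType) (D : rel T) (k : nat) (P : seq (seq T)) :
  irreflexive D -> in_semicomplete D -> 0 < k -> is_pack D k P ->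
  (exists C : {set {set T}}, coloring D C /\ orthogonal k C P) \/
  (exists Q : seq (seq T),
     [/\ is_pack D k Q,
         weight Q = (weight P).+1 &
         ends Q \subset ends P :|: ([set: T] :\: covered P)]).
Proof.
move=> irr semi _ packP.
have le_level j : #|level D j :&: covered P| <= minn #|level D j| k.
  rewrite leq_min subset_leq_card ?subsetIl //= -(count_meets_level _ packP).
  by apply: leq_trans (count_size _ _) _; case: packP.
pose M := (\max_u height (reach_lt D) u).+1.
have [/forallP sat|] := boolP [forall j : 'I_M,
    minn #|level D j| k <= #|level D j :&: covered P|].
  left; have [colC levels] := level_coloring irr.
  exists (preim_partition (height (reach_lt D)) setT); split=> // A AC.
  have [j Aj] := levels A AC; subst A; rewrite (count_meets_level _ packP).
  apply/eqP; rewrite eqn_leq le_level /=.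
  (* A nonempty level has index below [M], where [sat] applies. *)
  have [->|[v]] := set_0Vmem (level D j); first by rewrite cards0 min0n.
  rewrite inE => /eqP hv.
  have lt_j : j < M by rewrite ltnS -hv (leq_bigmax (F := height (reach_lt D))).
  exact: (sat (Ordinal lt_j)).
rewrite negb_forall => /existsP[j0]; rewrite -ltnNge => lt_j0; right.
have [L leL covL] := cover_levels (@reach_lt_irr _ D) (@reach_lt_trans _ D)
  (reach_lt_forest semi) k.
(* [g] sends a covered vertex to a path end it reaches and fixes the others, so [g @: L] consists of
   allowed ends and loses no ancestor. *)
have [g gP] : exists g : T -> T, forall l,
    g l \in ends P :|: ([set: T] :\: covered P) /\ connect D l (g l).
  apply: (fin_all_exists (P := fun l l' =>
    l' \in ends P :|: ([set: T] :\: covered P) /\ connect D l l')) => l.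
  have [/(connect_end packP)[e eP le]|lP] := boolP (l \in covered P).
    by exists e; rewrite inE eP.
  by exists l; rewrite in_setU in_setD lP in_setT orbT connect0.
have big : (weight P).+1 <= #|ancestors D (g @: L)|.
  rewrite /weight (sum_card_levels (reach_lt D)).
  rewrite (sum_card_levels (reach_lt D) (ancestors _ _)).
  have sub j : minn #|level D j| k <= #|level D j :&: ancestors D (g @: L)|.
    apply: leq_trans (covL j) _; apply/subset_leq_card/setIS/subsetP => v.
    rewrite !inE => /existsP[l /andP[lL vl]]; apply/existsP; exists (g l).
    rewrite imset_f //=; have [_] := gP l; apply: connect_trans.
    by case/predU1P: vl => [->|/andP[]]; rewrite ?connect0.
  (* The unsaturated level [j0] supplies the extra unit; the other levels compare weakly. *)
  rewrite (bigD1 j0) // [X in _ < X](bigD1 j0) //= -addSn; apply: leq_add.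
    exact: leq_trans lt_j0 (sub _).
  by apply: leq_sum => j _; apply: leq_trans (le_level j) (sub j).
have [Q [[uQ sQ dQ disQ] wQ eQ]] := pack_of_ancestors semi big.
exists Q; split=> //.
  split=> //; apply: leq_trans sQ _; exact: leq_trans (leq_imset_card _ _) leL.
apply: subset_trans eQ _; apply/subsetP => _ /imsetP[l _ ->].
by have [] := gP l.
Qed.
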